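(* Let $n\in\mathbb{N}=\{1,2,\dots\}$. The polynomial $Q_n(x)$ is unimodal and has at most two modes. Its smallest mode $m$ is the integer uniquely determined by $$\frac{\sqrt{5n^2+1}-1}{5}\le m<\frac{\sqrt{5n^2+1}+4}{5}.$$ The mode is unique if $5m^2+2m\ne n^2$. Furthermore, $Q_n(x)$ has two modes $m$ and $m+1$ if and only if there is an integer $k\ge1$ such that $(m,n)=(m_k,n_k)$, where $(m_k,n_k)$ is given by $$\begin{pmatrix}5m_k+1\\ n_k\end{pmatrix}=\begin{pmatrix}161&360\\72&161\end{pmatrix}^{k}\begin{pmatrix}1\\0\end{pmatrix}.$$
   Context: The polynomials $Q_n(x)$ are defined by $Q_0(x)=1$ and $Q_n(x)=x\sum_{k=1}^n k\,Q_{n-k}(x)$ for $n\ge 1$. The numbers $A_{n,k}$ are their coefficients: $Q_n(x)=\sum_{k=0}^n A_{n,k}x^k$. For $n\ge1$ and $0\le k\le n$ one has $A_{n,k}=\binom{n+k-1}{2k-1}$, with $A_{n,0}=0$. Unimodal means that there is an index $j$ with $A_{n,0}\le A_{n,1}\le\dots\le A_{n,j}\ge\dots\ge A_{n,n}$. A mode of $Q_n(x)$ is an index $j\in\{0,\dots,n\}$ with $A_{n,j}=\max_{0\le k\le n}A_{n,k}$. *)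

(* Defs.v *)
From mathcomp Require Import all_boot all_order all_algebra.

Set Implicit Arguments.
Unset Strict Implicit.
Unset Printing Implicit Defensive.

Import Order.TTheory GRing.Theory Num.Theory.
Local Open Scope ring_scope.

(* [Qseq n] is the list [:: Q_n; Q_(n-1); ...; Q_0], so that Q_(n+1-k) is the
   entry of index k-1 of [Qseq n]; see [Q0] and [Q_rec]. *)
Fixpoint Qseq (n : nat) : seq {poly int} :=
  if n is n'.+1 then
    'X * (\sum_(1 <= k < n.+1) k%:Z *: nth 0 (Qseq n') k.-1) :: Qseq n'
  else [:: 1].

Definition Q (n : nat) : {poly int} := head 0 (Qseq n).

Lemma nth_Qseq (n i : nat) : (i <= n)%N -> nth 0 (Qseq n) i = Q (n - i).
Proof.
elim: n i => [|n IHn] [|i] //= le_in.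
by rewrite IHn ?subSS.
Qed.

Lemma Q0 : Q 0 = 1.
Proof. by []. Qed.

Lemma Q_rec (n : nat) : (0 < n)%N ->
  Q n = 'X * \sum_(1 <= k < n.+1) k%:Z *: Q (n - k).
Proof.
case: n => // n _; rewrite {1}/Q /=; congr (_ * _).
apply: eq_big_nat => -[|k] //= lt_kn.
by rewrite nth_Qseq // subSS.
Qed.

Definition A (n k : nat) : int := (Q n)`_k.

Definition unimodal (n : nat) (a : nat -> int) : Prop :=
  exists j : nat,
    [/\ (j <= n)%N,
        forall i : nat, (i < j)%N -> a i <= a i.+1
      & forall i : nat, (j <= i < n)%N -> a i.+1 <= a i].

Definition is_mode (n j : nat) : bool :=
  (j <= n)%N && [forall k : 'I_n.+1, A n k <= A n j].

Definition modes (n : nat) : {set 'I_n.+1} := [set j : 'I_n.+1 | is_mode n j].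

Definition is_smallest_mode (n m : nat) : Prop :=
  is_mode n m /\ forall j : nat, is_mode n j -> (m <= j)%N.

Definition mx22 (a b c d : int) : 'M[int]_2 :=
  \matrix_(i < 2, j < 2) nth 0 (nth [::] [:: [:: a; b]; [:: c; d]] i) j.

Definition cv2 (a b : int) : 'cV[int]_2 := \col_(i < 2) nth 0 [:: a; b] i.

(* Main.v *)
Require Import Defs.
From mathcomp Require Import all_boot all_order all_algebra.
From mathcomp Require Import zify ring lra.

(** Everything is read off from the single quadratic form 5 k^2 + 2 k.
    By [A_binomial], A_{n,k+1} = 'C(n + k, 2k + 1), so for 1 <= k <= n
    consecutive coefficients have the ratio
      A_{n,k+1} / A_{n,k} = (n^2 - k^2) / (2k (2k + 1)),
    and A_{n,k+1} - A_{n,k} has the sign of n^2 - (5 k^2 + 2 k)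
    ([A_step_le], [A_step_ge]).  As 5 k^2 + 2 k increases with k, the
    coefficients rise strictly up to the first index m with
    n^2 <= 5 m^2 + 2 m ([peak]) and fall strictly from m + 1 on; the only
    possible tie is A_{n,m} = A_{n,m+1}, which happens exactly when
    5 m^2 + 2 m = n^2 ([is_modeE]).  This gives unimodality and the count of
    modes.  Completing the square, 5 (5 k^2 + 2 k) + 1 = (5 k + 1)^2, so
    minimality of m says 5 (m - 1) + 1 < sqrt (5 n^2 + 1) <= 5 m + 1, which is
    the claimed bracketing ([peak_sqrt]).

    The tie equation is the Pell equation x^2 - 5 n^2 = 1 with x = 5 m + 1.
    The matrix with rows (161, 360), (72, 161) is multiplication by the unit
    161 + 72 sqrt 5 = (9 + 4 sqrt 5)^2, and it preserves the class of x
    modulo 5.  Its inverse sends a solution with n >= 72 to a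
    smaller one with nonnegative entries, and no solution with x = 1 modulo 5
    has 0 < n < 72, so descent reaches (1, 0) ([pell_descent]).  The fundamental
    unit 9 + 4 sqrt 5 itself does not occur because 9 = -1 modulo 5. *)

Set Implicit Arguments.
Unset Strict Implicit.
Unset Printing Implicit Defensive.

Import Order.TTheory GRing.Theory Num.Theory.
Local Open Scope ring_scope.

(** * Coefficients of Q_n *)

Definition Qconv (n : nat) : {poly int} := \sum_(1 <= k < n.+1) k%:Z *: Q (n - k).

Definition Qsum (n : nat) : {poly int} := \sum_(0 <= i < n.+1) Q i.

(** Raising n by one raises each weight k by one, which adds one more copy of
    every earlier Q_i. *)
Lemma QconvS n : Qconv n.+1 = Qconv n + Qsum n.
Proof.
have shift : Qconv n.+1 = \sum_(0 <= k < n.+1) k.+1%:Z *: Q (n - k).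
  rewrite /Qconv big_add1 /=; apply: eq_big_nat => k _.
  by rewrite subSS.
have same : Qconv n = \sum_(0 <= k < n.+1) k%:Z *: Q (n - k).
  by rewrite [RHS]big_ltn // scale0r add0r.
rewrite shift same /Qsum [X in _ + X]big_nat_rev -big_split /=.
apply: eq_big_nat => k _.
by rewrite add0n subSS intS scalerDl scale1r addrC.
Qed.

(** The convolution and the partial sums are proved together: the recurrence of
    each involves the other, and both steps are Pascal's rule. *)
Lemma coef_Qconv_Qsum n :
  (forall k, (Qconv n)`_k = ('C(n + k, k.*2.+1))%:Z) /\
  (forall k, (Qsum n)`_k = ('C(n + k, k.*2))%:Z).
Proof.
elim: n => [|n [IHconv IHsum]].
  split=> k.
    by rewrite /Qconv big_geq // coef0 bin_small //; lia.
  rewrite /Qsum big_nat1 Q0 coef1; case: k => [|k] //=.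
  by rewrite bin_small //; lia.
have conv k : (Qconv n.+1)`_k = ('C(n.+1 + k, k.*2.+1))%:Z.
  by rewrite QconvS coefD IHconv IHsum addSn binS PoszD.
split=> // k.
rewrite /Qsum big_nat_recr //= -/(Qsum n) coefD IHsum Q_rec // coefXM.
case: k => [|k] /=; first by rewrite !bin0.
rewrite -/(Qconv n.+1) conv doubleS !addnS !addSn (binS (n + k).+1) PoszD.
by [].
Qed.

Lemma A0 n : (0 < n)%N -> A n 0 = 0.
Proof. by move=> n_gt0; rewrite /A Q_rec // coefXM. Qed.

Lemma A_binomial n k : (0 < n)%N -> A n k.+1 = ('C(n + k, k.*2.+1))%:Z.
Proof.
move=> n_gt0; rewrite /A Q_rec // coefXM /= -/(Qconv n).
by have [->] := coef_Qconv_Qsum n.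
Qed.

Lemma A_gt0 n k : (0 < k <= n)%N -> 0 < A n k.
Proof.
case: k => // k /= lt_kn.
rewrite A_binomial; last by lia.
by rewrite ltz_nat bin_gt0; lia.
Qed.

(** Two absorption steps ('C(N + 1, 2k + 1) to 'C(N, 2k) to 'C(N, 2k - 1)) with
    N = n + k - 1.  At k = n both sides vanish, so the identity also covers the
    step past the last coefficient. *)
Lemma A_ratio n k : (0 < k <= n)%N ->
  A n k.+1 * ((2 * k * (2 * k + 1))%N)%:Z = A n k * (n%:Z ^+ 2 - k%:Z ^+ 2).
Proof.
case: k => // j /= lt_jn.
have n_gt0 : (0 < n)%N by lia.
rewrite !A_binomial // doubleS addnS.
have diag := mul_bin_diag (n + j).+1 j.*2.+2.
have absorb := mul_bin_left (n + j) j.*2.+1.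
rewrite /= in diag.
have dif : (n + j - j.*2.+1 = n - j.+1)%N by lia.
rewrite dif in absorb.
have -> : n%:Z ^+ 2 - j.+1%:Z ^+ 2 = ((n + j).+1 * (n - j.+1))%N%:Z by nia.
rewrite -!PoszM; congr Posz.
have -> : (2 * j.+1 * (2 * j.+1 + 1) = j.*2.+3 * j.*2.+2)%N by lia.
by rewrite mulnA [('C(_, _) * j.*2.+3)%N]mulnC -diag -mulnA
           [('C(_, _) * j.*2.+2)%N]mulnC absorb; ring.
Qed.

(** * The sign of the successive differences *)

(** By [A_ratio] the comparison amounts to 2k (2k + 1) <= n^2 - k^2.  The index
    k = 0 is separate, because A_{n,0} = 0 makes the ratio meaningless there, but
    it obeys the same criterion. *)
Lemma A_step_le n k : (0 < n)%N -> (k <= n)%N ->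
  (A n k <= A n k.+1) = (5 * k ^ 2 + 2 * k <= n ^ 2)%N.
Proof.
move=> n_gt0; case: k => [|k] le_kn.
  by rewrite A0 // ltW // A_gt0 //.
have ak_gt0 : 0 < A n k.+1 by apply: A_gt0.
have ratio : A n k.+2 * _ = _ := A_ratio (k := k.+1) le_kn.
set c := (_%:Z) in ratio.
have c_gt0 : 0 < c by rewrite /c; lia.
rewrite -(ler_pM2r c_gt0) ratio (ler_pM2l ak_gt0) /c.
by apply/idP/idP; nia.
Qed.

Lemma A_step_ge n k : (0 < n)%N -> (k <= n)%N ->
  (A n k.+1 <= A n k) = (n ^ 2 <= 5 * k ^ 2 + 2 * k)%N.
Proof.
move=> n_gt0; case: k => [|k] le_kn.
  rewrite A0 // leNgt A_gt0 //=; lia.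
have ak_gt0 : 0 < A n k.+1 by apply: A_gt0.
have ratio : A n k.+2 * _ = _ := A_ratio (k := k.+1) le_kn.
set c := (_%:Z) in ratio.
have c_gt0 : 0 < c by rewrite /c; lia.
rewrite -(ler_pM2r c_gt0) ratio (ler_pM2l ak_gt0) /c.
by apply/idP/idP; nia.
Qed.

(** * The modes *)

(** The location of the mode, expressed through the sign criterion for the
    differences instead of the coefficients themselves. *)
Definition peak n m : Prop :=
  (n ^ 2 <= 5 * m ^ 2 + 2 * m)%N /\
  forall k, (k < m)%N -> (5 * k ^ 2 + 2 * k < n ^ 2)%N.

Lemma peak_exists n : exists m, peak n m.
Proof.
have ex : exists m, (n ^ 2 <= 5 * m ^ 2 + 2 * m)%N by exists n; nia.
case: (ex_minnP ex) => m le_m min_m; exists m; split=> // k lt_km.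
by rewrite ltnNge; apply/negP => /min_m; rewrite leqNgt lt_km.
Qed.

Lemma peak_le n m : peak n m -> (m <= n)%N.
Proof.
case=> _ below; rewrite leqNgt; apply/negP => /below; nia.
Qed.

Lemma A_lt_peak n m i j : (0 < n)%N -> peak n m ->
  (i < j)%N -> (j <= m)%N -> A n i < A n j.
Proof.
move=> n_gt0 pk; have le_mn := peak_le pk; case: pk => _ below.
elim: j => // j IHj; rewrite ltnS leq_eqVlt => lt_ij le_jm.
have step : A n j < A n j.+1.
  by rewrite ltNge A_step_ge //; [rewrite -ltnNge below | lia].
case/orP: lt_ij => [/eqP -> // | lt_ij].
by apply: lt_trans (IHj lt_ij _) step; lia.
Qed.

Lemma A_gt_peak n m i j : (0 < n)%N -> peak n m ->
  (m < i)%N -> (i < j)%N -> (j <= n)%N -> A n j < A n i.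
Proof.
move=> n_gt0 [above _] lt_mi.
elim: j => // j IHj; rewrite ltnS leq_eqVlt => lt_ij le_jn.
have step : A n j.+1 < A n j.
  rewrite ltNge A_step_le //; last by lia.
  rewrite -ltnNge; have : (m < j)%N by case/orP: lt_ij => [/eqP <-|]; lia.
  nia.
case/orP: lt_ij => [/eqP -> // | lt_ij].
by apply: lt_trans step (IHj lt_ij _); lia.
Qed.

Lemma A_le_peak n m j : (0 < n)%N -> peak n m -> (j <= n)%N -> A n j <= A n m.
Proof.
move=> n_gt0 pk le_jn; have le_mn := peak_le pk.
case: (ltngtP j m) => [lt_jm | lt_mj | -> //].
  by rewrite ltW // (A_lt_peak n_gt0 pk).
have first_step : A n m.+1 <= A n m by rewrite A_step_ge //; case: pk.
move: lt_mj; rewrite leq_eqVlt => /orP[/eqP <- // | lt_mj].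
by apply: le_trans first_step; rewrite ltW // (A_gt_peak n_gt0 pk).
Qed.

Lemma is_modeP n j :
  reflect ((j <= n)%N /\ forall k, (k <= n)%N -> A n k <= A n j) (is_mode n j).
Proof.
apply: (iffP andP) => -[le_jn max_j]; split=> //.
  move=> k le_kn; have lt_kn : (k < n.+1)%N by [].
  exact: (forallP max_j (Ordinal lt_kn)).
by apply/forallP => k; apply: max_j; rewrite -ltnS.
Qed.

Lemma is_modeE n m j : (0 < n)%N -> peak n m ->
  is_mode n j <-> j = m \/ (j = m.+1 /\ (5 * m ^ 2 + 2 * m = n ^ 2)%N).
Proof.
move=> n_gt0 pk; have le_mn := peak_le pk; have [above _] := pk.
split=> [/is_modeP[le_jn max_j] | [-> | [-> tie]]]; last 1 first.
- (* A tie forces m < n, so that m.+1 is an admissible index. *)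
  have lt_mn : (m < n)%N by nia.
  apply/is_modeP; split=> // k le_kn.
  apply: le_trans (A_le_peak n_gt0 pk le_kn) _.
  by rewrite A_step_le // tie.
- case: (ltngtP j m) => [lt_jm | lt_mj | ->]; [ | right | by left].
    by have := max_j m le_mn; rewrite leNgt (A_lt_peak n_gt0 pk).
  have jE : j = m.+1.
    move: lt_mj; rewrite leq_eqVlt => /orP[/eqP // | lt_mj].
    have := max_j m.+1 (leq_trans (ltnW lt_mj) le_jn).
    by rewrite leNgt (A_gt_peak n_gt0 pk).
  split=> //; apply/eqP; rewrite eqn_leq above andbT.
  by rewrite -A_step_le // -jE max_j.
- by apply/is_modeP; split=> // k; apply: A_le_peak.
Qed.

Lemma A_unimodal n : (0 < n)%N -> unimodal n (A n).
Proof.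
move=> n_gt0; have [m pk] := peak_exists n; have le_mn := peak_le pk.
have [above _] := pk.
exists m; split=> // [i lt_im | i /andP[le_mi lt_in]].
  by rewrite ltW // (A_lt_peak n_gt0 pk).
rewrite A_step_ge //; last by lia.
by apply: leq_trans above _; nia.
Qed.

Lemma card_modes n : (0 < n)%N -> (#|modes n| <= 2)%N.
Proof.
move=> n_gt0; have [m pk] := peak_exists n.
rewrite cardE -(size_map val).
apply: (@uniq_leq_size _ _ [:: m; m.+1]).
  by rewrite (map_inj_uniq val_inj) enum_uniq.
move=> j /mapP[i]; rewrite mem_enum inE => /(is_modeE _ n_gt0 pk) mode_i ->.
by rewrite !inE /=; case: mode_i => [-> | [-> _]]; rewrite eqxx ?orbT.
Qed.

Lemma peak_smallest_mode n m : (0 < n)%N -> peak n m -> is_smallest_mode n m.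
Proof.
move=> n_gt0 pk; split=> [|j]; first by apply/(is_modeE _ n_gt0 pk); left.
by move/(is_modeE _ n_gt0 pk) => [-> | [-> _]].
Qed.

(** From right to left, a tie at m already makes m the peak, since
    5 k^2 + 2 k is strictly increasing. *)
Lemma two_modesE n m : (0 < n)%N ->
  (forall j, is_mode n j <-> j = m \/ j = m.+1) <-> (5 * m ^ 2 + 2 * m = n ^ 2)%N.
Proof.
move=> n_gt0; split=> [modesE | tie].
  have [p pk] := peak_exists n; have mode j := is_modeE j n_gt0 pk.
  have /mode := (modesE m).2 (or_introl erefl).
  have /mode := (modesE m.+1).2 (or_intror erefl).
  by case=> [<- | [[->] //]] [|[]]; lia.
have pk : peak n m by split=> [|k]; nia.
move=> j; rewrite (is_modeE j n_gt0 pk).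
by split=> [[|[]] | []]; auto.
Qed.

(** * Bracketing by the square root *)

(** Both bounds are the two halves of [peak] after completing the square, the
    lower one at m - 1, where 5 (m - 1) + 1 = 5 m - 4; here m is positive
    because n is. *)
Lemma peak_sqrt (R : rcfType) n m : (0 < n)%N -> peak n m ->
  5 * m%:R - 4 < Num.sqrt (5 * n%:R ^+ 2 + 1 : R) <= 5 * m%:R + 1.
Proof.
move=> n_gt0 [above below].
have m_gt0 : (0 < m)%N by nia.
have low_ge0 : 0 <= 5 * m.-1%:R + 1 :> R by rewrite addr_ge0 ?mulr_ge0.
have high_ge0 : 0 <= 5 * m%:R + 1 :> R by rewrite addr_ge0 ?mulr_ge0.
apply/andP; split.
  have -> : 5 * m%:R - 4 = 5 * m.-1%:R + 1 :> R.
    by rewrite -[in LHS](prednK m_gt0) -natr1; ring.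
  rewrite -[X in X < _](ger0_norm low_ge0) -sqrtr_sqr ltr_sqrt; last first.
    by rewrite ltr_pwDr ?mulr_ge0 ?sqr_ge0.
  have : (5 * m.-1 ^ 2 + 2 * m.-1 < n ^ 2)%N by apply: below; lia.
  rewrite -(ltr_nat R) natrD !natrM ?natrX; nra.
rewrite -[X in _ <= X](ger0_norm high_ge0) -sqrtr_sqr ler_wsqrtr //.
move: above; rewrite -(ler_nat R) natrD !natrM ?natrX; nra.
Qed.

(** The bracketing interval is half-open of length 1, so it contains only one
    integer. *)
Lemma peak_sqrtE (R : rcfType) n m (z : int) : (0 < n)%N -> peak n m ->
  ((Num.sqrt (5 * n%:R ^+ 2 + 1) - 1) / 5 <= z%:~R :> R) /\
  (z%:~R < (Num.sqrt (5 * n%:R ^+ 2 + 1) + 4) / 5 :> R) <-> z = m%:Z.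
Proof.
move=> n_gt0 pk; set s : R := Num.sqrt _.
have /andP[low high] : 5 * m%:R - 4 < s <= 5 * m%:R + 1 by apply: peak_sqrt.
split=> [[low_z high_z] | ->]; last by rewrite -pmulrn; split; lra.
have lt_zm : z < m%:Z + 1.
  by rewrite -(ltr_int R) intrD -pmulrn; lra.
have lt_mz : m%:Z < z + 1.
  by rewrite -(ltr_int R) intrD -[m%:~R]pmulrn; lra.
lia.
Qed.

(** * The Pell equation *)

Lemma mul_mx22_cv2 a b c d x y :
  mx22 a b c d *m cv2 x y = cv2 (a * x + b * y) (c * x + d * y).
Proof.
apply/colP => i; rewrite !mxE big_ord_recl big_ord1 !mxE /=.
by case: i => [[|[|]]].
Qed.

Lemma cv2_inj a b c d : cv2 a b = cv2 c d -> a = c /\ b = d.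
Proof.
move=> eq_cv; split.
  by have /colP/(_ 0) := eq_cv; rewrite !mxE.
by have /colP/(_ 1) := eq_cv; rewrite !mxE.
Qed.

Definition pell_orbit k : 'cV[int]_2 := mx22 161 360 72 161 ^+ k *m cv2 1 0.

Lemma pell_orbitS k : pell_orbit k.+1 = mx22 161 360 72 161 *m pell_orbit k.
Proof. by rewrite /pell_orbit exprS mulmxA. Qed.

(** 161^2 - 5 * 72^2 = 1, so the matrix preserves the norm x^2 - 5 y^2. *)
Lemma pell_orbit_norm k :
  exists x y, pell_orbit k = cv2 x y /\ x ^+ 2 = 5 * y ^+ 2 + 1.
Proof.
elim: k => [|k [x [y [orbE norm]]]].
  by exists 1, 0; rewrite /pell_orbit expr0 mul1mx.
rewrite pell_orbitS orbE mul_mx22_cv2; do 2!eexists; split; first by [].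
by move: norm; nia.
Qed.

Lemma no_small_tie m n : (0 < n)%N -> (n < 72)%N ->
  (5 * m ^ 2 + 2 * m)%N <> (n ^ 2)%N.
Proof.
move=> n_gt0 lt_n tie; have lt_m : (m < 72)%N by nia.
have chk : all (fun i => all (fun j => (5 * j ^ 2 + 2 * j != i ^ 2)%N)
                             (iota 0 72)) (iota 1 71).
  by vm_compute.
have n_in : n \in iota 1 71 by rewrite mem_iota; lia.
have m_in : m \in iota 0 72 by rewrite mem_iota; lia.
have /allP/(_ m m_in) := allP chk n n_in.
by rewrite tie eqxx.
Qed.

(** Descent: multiplication by the inverse unit 161 - 72 sqrt 5 takes (5 m + 1, n) to
    (5 m' + 1, n') with m' = 161 m + 32 - 72 n and n' = 161 n - 360 m - 72.
    With x = 5 m + 1, the Pell equation gives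
    (161 n)^2 - (72 x)^2 = n^2 - 72^2, so n' is nonnegative exactly when
    72 <= n. *)
Lemma pell_descent m n : (5 * m ^ 2 + 2 * m = n ^ 2)%N ->
  exists k, cv2 (5 * m%:Z + 1) n%:Z = pell_orbit k.
Proof.
have [b] := ubnP n; elim: b m n => // b IHb m n lt_nb tie.
case: (posnP n) => [n0 | n_gt0].
  have -> : m = 0%N by move: tie; rewrite n0; nia.
  by exists 0%N; rewrite /pell_orbit expr0 mul1mx n0 mulr0 add0r.
(* x = 5 m + 1 excludes (9, 4), the only solution with 0 < n < 72. *)
have le72n : (72 <= n)%N.
  by rewrite leqNgt; apply/negP => lt_n; apply: no_small_tie tie.
have n'_ge0 : (360 * m + 72 <= 161 * n)%N by nia.
have m'_ge0 : (72 * n <= 161 * m + 32)%N by nia.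
have n'_lt : (161 * n - (360 * m + 72) < n)%N by nia.
have [||k orbE] :=
  IHb (161 * m + 32 - 72 * n)%N (161 * n - (360 * m + 72))%N.
- by lia.
- apply/eqP; rewrite -eqz_nat; apply/eqP.
  rewrite PoszD !PoszM -!subzn // ?PoszD ?PoszM.
  by move: tie; nia.
exists k.+1; rewrite pell_orbitS -orbE mul_mx22_cv2.
by congr cv2; lia.
Qed.

Lemma tie_pell_orbit m n : (0 < n)%N ->
  (5 * m ^ 2 + 2 * m = n ^ 2)%N <->
  exists k, (1 <= k)%N /\ cv2 (5 * m%:Z + 1) n%:Z = pell_orbit k.
Proof.
move=> n_gt0; split=> [/pell_descent[[|k] orbE] | [k [_ orbE]]].
- move: orbE; rewrite /pell_orbit expr0 mul1mx => /cv2_inj[_]; lia.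
- by exists k.+1.
have [x [y [orbE' norm]]] := pell_orbit_norm k.
move: orbE; rewrite orbE' => /cv2_inj[xE yE].
by move: norm; rewrite -xE -yE; nia.
Qed.

Theorem theorem1p6 (R : rcfType) (n : nat) (n_gt0 : (0 < n)%N) :
  [/\ unimodal n (A n),
      (#|modes n| <= 2)%N,
      exists m : nat,
        [/\ is_smallest_mode n m,
            forall z : int,
              ((Num.sqrt (5 * n%:R ^+ 2 + 1) - 1) / 5 <= z%:~R :> R) /\
              (z%:~R < (Num.sqrt (5 * n%:R ^+ 2 + 1) + 4) / 5 :> R)
              <-> z = m%:Z
          & (5 * m ^ 2 + 2 * m)%N <> (n ^ 2)%N ->
            forall j : nat, is_mode n j -> j = m]
    & forall m : nat,
        (forall j : nat, is_mode n j <-> j = m \/ j = m.+1) <->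
        (exists k : nat, (1 <= k)%N /\
           cv2 (5 * m%:Z + 1) n%:Z = mx22 161 360 72 161 ^+ k *m cv2 1 0)].
Proof.
split.
- exact: A_unimodal.
- exact: card_modes.
- have [m pk] := peak_exists n; exists m; split.
  + exact: peak_smallest_mode.
  + by move=> z; apply: peak_sqrtE.
  + by move=> no_tie j /(is_modeE j n_gt0 pk) [-> | [_ /no_tie]].
- by move=> m; rewrite two_modesE //; apply: tie_pell_orbit.
Qed.
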